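(* There is an infinite chain of equivalence relations on $\omega$ which are enumerable in indices and lie between $=^{ce}$ and $E_0^{ce}$: namely, there are equivalence relations $R_1,R_2,\ldots$ on $\omega$, each enumerable in indices, such that $=^{ce}\ \le_c R_n\le_c E_0^{ce}$ and $R_n<_c R_{n+1}$ for every $n\ge1$.
   Context: $(W_e)_{e\in\omega}$ is a standard uniform enumeration of the c.e.\ subsets of $\omega$. $i=^{ce}j\iff W_i=W_j$; $i\,E_0^{ce}\,j\iff W_i\triangle W_j$ is finite. $E\le_c F$ means there is a computable $f$ with $x\,E\,y\iff f(x)\,F\,f(y)$; $E<_c F$ means $E\le_c F$ and $F\not\le_c E$. An equivalence relation $R$ on $\omega$ with $W_i=W_j\Rightarrow i\,R\,j$ (i.e., $R$ is of the form $i\,R\,j\iff W_i\,E\,W_j$ for an equivalence relation $E$ on $2^\omega$) is enumerable in indices if there is a computable $\alpha:\omega\times\omega\to\omega$ such that $i\,R\,j\iff(\exists n)(W_{\alpha(i,n)}=W_j)$. *)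

(* Defs.v *)
From Stdlib Require Import Arith Lia List RelationClasses Cantor.

Definition cpair (x y : nat) : nat := Cantor.to_nat (x, y).
Definition cfst (n : nat) : nat := fst (Cantor.of_nat n).
Definition csnd (n : nat) : nat := snd (Cantor.of_nat n).

(* Programs for the unary partial recursive functions; several arguments are
   passed through the pairing function. *)
Inductive code : Type :=
| Zero | Succ | Fst | Snd
| Pair (c d : code)
| Comp (c d : code)
| Prec (c d : code)
| Mu (c : code).

(* [eval c x y]: program [c] converges on input [x] with output [y].
   - [Comp c d] runs [d] first;
   - h := [Prec c d] satisfies h <a,0> = c a and
     h <a,k+1> = d <a,<k,h <a,k>>>;
   - [Mu c] maps x to the least y with c <x,y> = 0, provided that c <x,m>
     converges for all m < y. *)
Fixpoint eval (c : code) (x y : nat) {struct c} : Prop :=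
  match c with
  | Zero => y = 0
  | Succ => y = S x
  | Fst => y = cfst x
  | Snd => y = csnd x
  | Pair c d => exists u v, eval c x u /\ eval d x v /\ y = cpair u v
  | Comp c d => exists u, eval d x u /\ eval c u y
  | Prec c d =>
      nat_rect (fun _ => nat -> Prop)
        (eval c (cfst x))
        (fun k h z => exists u, h u /\ eval d (cpair (cfst x) (cpair k u)) z)
        (csnd x) y
  | Mu c =>
      eval c (cpair x y) 0 /\
      forall m, m < y -> exists z, eval c (cpair x m) (S z)
  end.

Fixpoint encode (c : code) : nat :=
  match c with
  | Zero => cpair 0 0
  | Succ => cpair 1 0
  | Fst => cpair 2 0
  | Snd => cpair 3 0
  | Pair c d => cpair 4 (cpair (encode c) (encode d))
  | Comp c d => cpair 5 (cpair (encode c) (encode d))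
  | Prec c d => cpair 6 (cpair (encode c) (encode d))
  | Mu c => cpair 7 (encode c)
  end.

Fixpoint decode_fuel (k n : nat) {struct k} : code :=
  match k with
  | 0 => Zero
  | S k =>
      let m := csnd n in
      match cfst n with
      | 0 => Zero
      | 1 => Succ
      | 2 => Fst
      | 3 => Snd
      | 4 => Pair (decode_fuel k (cfst m)) (decode_fuel k (csnd m))
      | 5 => Comp (decode_fuel k (cfst m)) (decode_fuel k (csnd m))
      | 6 => Prec (decode_fuel k (cfst m)) (decode_fuel k (csnd m))
      | _ => Mu (decode_fuel k m)
      end
  end.

(* Every number is an index. The fuel [S n] never runs out, since whenever
   [cfst n > 0] the recursive calls are on numbers smaller than [n]. *)
Definition decode (n : nat) : code := decode_fuel (S n) n.

Lemma cfst_cpair x y : cfst (cpair x y) = x.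
Proof. unfold cfst, cpair. now rewrite Cantor.cancel_of_to. Qed.

Lemma csnd_cpair x y : csnd (cpair x y) = y.
Proof. unfold csnd, cpair. now rewrite Cantor.cancel_of_to. Qed.

Lemma cpair_eta n : cpair (cfst n) (csnd n) = n.
Proof.
  unfold cfst, csnd, cpair. rewrite <- surjective_pairing.
  apply Cantor.cancel_to_of.
Qed.

Lemma cpair_le x y : y + x <= cpair x y.
Proof. apply Cantor.to_nat_non_decreasing. Qed.

Lemma decode_fuel_eq k l n : n < k -> n < l -> decode_fuel k n = decode_fuel l n.
Proof.
  revert l n. induction k as [|k IH]; intros [|l] n Hk Hl; try lia.
  cbn [decode_fuel].
  pose proof (cpair_le (cfst n) (csnd n)) as H1. rewrite cpair_eta in H1.
  pose proof (cpair_le (cfst (csnd n)) (csnd (csnd n))) as H2.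
  rewrite cpair_eta in H2.
  destruct (cfst n) as [|[|[|[|[|[|[|t]]]]]]]; try reflexivity;
    f_equal; apply IH; lia.
Qed.

Lemma decode_eq n :
  decode n =
    let m := csnd n in
    match cfst n with
    | 0 => Zero
    | 1 => Succ
    | 2 => Fst
    | 3 => Snd
    | 4 => Pair (decode (cfst m)) (decode (csnd m))
    | 5 => Comp (decode (cfst m)) (decode (csnd m))
    | 6 => Prec (decode (cfst m)) (decode (csnd m))
    | _ => Mu (decode m)
    end.
Proof.
  unfold decode at 1. cbn [decode_fuel]. unfold decode. cbv zeta.
  pose proof (cpair_le (cfst n) (csnd n)) as H1. rewrite cpair_eta in H1.
  pose proof (cpair_le (cfst (csnd n)) (csnd (csnd n))) as H2.
  rewrite cpair_eta in H2.
  destruct (cfst n) as [|[|[|[|[|[|[|t]]]]]]]; try reflexivity;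
    f_equal; apply decode_fuel_eq; lia.
Qed.

Lemma decode_encode c : decode (encode c) = c.
Proof.
  induction c; cbn [encode]; rewrite decode_eq; cbv zeta;
    rewrite ?cfst_cpair, ?csnd_cpair, ?cfst_cpair, ?csnd_cpair; congruence.
Qed.

Definition W (e x : nat) : Prop := exists y, eval (decode e) x y.

Definition computable (f : nat -> nat) : Prop :=
  exists c, forall x, eval c x (f x).

Definition computable2 (f : nat -> nat -> nat) : Prop :=
  exists c, forall x y, eval c (cpair x y) (f x y).

Definition eq_ce (i j : nat) : Prop := forall x, W i x <-> W j x.

Definition E0_ce (i j : nat) : Prop :=
  exists l : list nat,
    forall x, (W i x /\ ~ W j x) \/ (W j x /\ ~ W i x) -> In x l.

Definition reducible (E F : nat -> nat -> Prop) : Prop :=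
  exists f, computable f /\ forall x y, E x y <-> F (f x) (f y).

Definition strictly_reducible (E F : nat -> nat -> Prop) : Prop :=
  reducible E F /\ ~ reducible F E.

Definition enumerable_in_indices (R : nat -> nat -> Prop) : Prop :=
  (forall i j, eq_ce i j -> R i j) /\
  exists alpha, computable2 alpha /\
    forall i j, R i j <-> exists n, eq_ce (alpha i n) j.

(* Main.v *)
(* View a subset of omega as a sequence of columns.  The relation R_n compares
   the columns from n on for equality; a column c < n is compared only through
   its tail, the part that starts at its first gap, so that a full column forms
   a class by itself.  A computable search for shifts lists each class, and the
   first gap is a limit of stagewise approximations, whence R_n <= E_0^ce.

   Let T_t consist of the first t columns, for t <= n + 1.  Filling column t of
   T_t one element at a time stays in the R_{n+1}-class of T_t but has the limit
   T_{t+1}.  Let f reduce R_{n+1} to R_n.  By the recursion theorem, a property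
   that is approximated in the limit cannot separate f(T_t) from f(T_{t+1}), so
   the columns that are full in f(T_t) stay full in f(T_{t+1}) and the only
   possible difference is that a new column below n becomes full.  With n + 1
   steps and n columns this is impossible. *)
Require Import Defs.
From Stdlib Require Import Arith Lia List RelationClasses Classical.

(** * Closure properties of total computable functions *)

Lemma computable_ext f g :
  (forall x, f x = g x) -> computable f -> computable g.
Proof. intros E [c Hc]. exists c. intros x. now rewrite <- E. Qed.

Lemma computable_id : computable (fun x => x).
Proof.
  exists (Pair Fst Snd). intros x. exists (cfst x), (csnd x).
  now rewrite cpair_eta.
Qed.

Lemma computable_comp g f :
  computable g -> computable f -> computable (fun x => g (f x)).
Proof. intros [c Hc] [d Hd]. exists (Comp c d). intros x. now exists (f x). Qed.

Lemma computable_S f : computable f -> computable (fun x => S (f x)).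
Proof. apply computable_comp. now exists Succ. Qed.

Lemma computable_const a : computable (fun _ => a).
Proof. induction a; [now exists Zero | now apply computable_S]. Qed.

Lemma computable_cfst f : computable f -> computable (fun x => cfst (f x)).
Proof. apply computable_comp. now exists Fst. Qed.

Lemma computable_csnd f : computable f -> computable (fun x => csnd (f x)).
Proof. apply computable_comp. now exists Snd. Qed.

Lemma computable_cpair f g :
  computable f -> computable g -> computable (fun x => cpair (f x) (g x)).
Proof.
  intros [c Hc] [d Hd]. exists (Pair c d). intros x. now exists (f x), (g x).
Qed.

(** [Prec] supplies its step program with the triple of parameter, counter and previous value; the
    whole argument [x] serves as the parameter. *)
Lemma computable_rec a b n :
  computable a ->
  computable (fun z => b (cfst z) (cfst (csnd z)) (csnd (csnd z))) ->
  computable n ->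
  computable (fun x => nat_rect (fun _ => nat) (a x) (b x) (n x)).
Proof.
  intros [ca Ha] [cb Hb] Hn.
  enough (computable
    (fun z => nat_rect (fun _ => nat) (a (cfst z)) (b (cfst z)) (csnd z))) as H.
  { eapply computable_ext;
      [|exact (computable_comp _ _ H (computable_cpair _ _ computable_id Hn))].
    intros x. cbv beta. now rewrite cfst_cpair, csnd_cpair. }
  exists (Prec ca cb). intros z. cbn [eval].
  induction (csnd z) as [|k IH]; cbn [nat_rect]; [apply Ha|].
  eexists. split; [exact IH|].
  set (r := nat_rect _ _ _ k).
  specialize (Hb (cpair (cfst z) (cpair k r))).
  now rewrite !csnd_cpair, !cfst_cpair in Hb.
Qed.

Lemma computable_match a b n :
  computable a -> computable (fun z => b (cfst z) (csnd z)) -> computable n ->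
  computable (fun x => match n x with 0 => a x | S k => b x k end).
Proof.
  intros Ha Hb Hn.
  apply computable_ext
    with (fun x => nat_rect (fun _ => nat) (a x) (fun k _ => b x k) (n x)).
  { intros x. now destruct (n x). }
  apply (computable_rec a (fun x k _ => b x k) n); try assumption.
  eapply computable_ext; [|refine (computable_comp _
    (fun z => cpair (cfst z) (cfst (csnd z))) Hb _)].
  - intros z. cbv beta. now rewrite cfst_cpair, csnd_cpair.
  - apply computable_cpair; repeat (apply computable_cfst || apply computable_csnd);
      apply computable_id.
Qed.

Lemma computable_add f g :
  computable f -> computable g -> computable (fun x => f x + g x).
Proof.
  intros Hf Hg.
  apply computable_ext
    with (fun x => nat_rect (fun _ => nat) (f x) (fun _ r => S r) (g x)).
  { intros x. induction (g x); cbn [nat_rect]; lia. }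
  apply (computable_rec f (fun _ _ r => S r) g); try assumption.
  apply computable_S, computable_csnd, computable_csnd, computable_id.
Qed.

Lemma computable_sub f g :
  computable f -> computable g -> computable (fun x => f x - g x).
Proof.
  intros Hf Hg.
  apply computable_ext
    with (fun x => nat_rect (fun _ => nat) (f x)
               (fun _ r => match r with 0 => 0 | S k => k end) (g x)).
  { intros x. induction (g x) as [|m IH]; cbn [nat_rect]; [lia|].
    rewrite IH. destruct (f x - m) eqn:E; lia. }
  apply (computable_rec f
           (fun _ _ r => match r with 0 => 0 | S k => k end) g); try assumption.
  apply (computable_match (fun _ => 0) (fun _ k => k) (fun z => csnd (csnd z))).
  - apply computable_const.
  - apply computable_csnd, computable_id.
  - apply computable_csnd, computable_csnd, computable_id.
Qed.

(** Pairs are nested to the left, so that [Mu] can search over the last argument. *)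
Definition computable3 (f : nat -> nat -> nat -> nat) : Prop :=
  computable (fun w => f (cfst (cfst w)) (csnd (cfst w)) (csnd w)).

Lemma computable_app2 f a b :
  computable (fun z => f (cfst z) (csnd z)) -> computable a -> computable b ->
  computable (fun x => f (a x) (b x)).
Proof.
  intros Hf Ha Hb. eapply computable_ext;
    [|exact (computable_comp _ _ Hf (computable_cpair _ _ Ha Hb))].
  intros x. cbv beta. now rewrite cfst_cpair, csnd_cpair.
Qed.

Lemma computable_app3 f a b c :
  computable3 f -> computable a -> computable b -> computable c ->
  computable (fun x => f (a x) (b x) (c x)).
Proof.
  intros Hf Ha Hb Hc.
  eapply computable_ext; [|refine (computable_comp _ _ Hf
    (computable_cpair _ _ (computable_cpair _ _ Ha Hb) Hc))].
  intros x. cbv beta. now rewrite !cfst_cpair, !csnd_cpair.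
Qed.

Lemma computable2_intro f :
  computable (fun z => f (cfst z) (csnd z)) -> computable2 f.
Proof.
  intros [c Hc]. exists c. intros x y. specialize (Hc (cpair x y)).
  now rewrite cfst_cpair, csnd_cpair in Hc.
Qed.

Lemma computable2_elim f :
  computable2 f -> computable (fun z => f (cfst z) (csnd z)).
Proof.
  intros [c Hc]. exists c. intros z. rewrite <- (cpair_eta z) at 1. apply Hc.
Qed.

Create HintDb computable.

(** Recursion on the syntax of the function; the basic operations are tried before the generic
    applications, whose head must be settled by the hint database. *)
Ltac computability :=
  cbv beta;
  lazymatch goal with
  | |- computable3 _ => unfold computable3; computability
  | |- computable2 _ => apply computable2_intro; computability
  | |- computable (fun _ => ?a) => exact (computable_const a)
  | |- computable (fun x => x) => exact computable_id
  | |- computable (fun x => match @?n x with 0 => @?a x | S k => @?b x k end) =>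
      apply (computable_match a b n); computability
  | |- computable (fun x => nat_rect (fun _ => nat) (@?a x)
                              (fun k r => @?b x k r) (@?n x)) =>
      apply (computable_rec a b n); computability
  | |- computable (fun x => S (@?f x)) => apply (computable_S f); computability
  | |- computable (fun x => cfst (@?f x)) =>
      apply (computable_cfst f); computability
  | |- computable (fun x => csnd (@?f x)) =>
      apply (computable_csnd f); computability
  | |- computable (fun x => cpair (@?f x) (@?g x)) =>
      apply (computable_cpair f g); computability
  | |- computable (fun x => @?f x + @?g x) =>
      apply (computable_add f g); computability
  | |- computable (fun x => @?f x - @?g x) =>
      apply (computable_sub f g); computability
  | |- computable (fun x => ?f (@?a x) (@?b x) (@?c x)) =>
      apply (computable_app3 f a b c);
      [solve [auto with computable] | computability ..]
  | |- computable (fun x => ?f (@?a x) (@?b x)) =>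
      apply (computable_app2 f a b);
      [solve [auto using computable2_elim with computable] | computability ..]
  | |- computable (fun x => ?f (@?a x)) =>
      apply (computable_comp f a);
      [solve [auto with computable] | computability]
  end.

(** * A universal machine *)

(* A state either evaluates the program with index [e] on [x], or returns [y],
   to the stack [K].  A stack is 0 or a frame with tag [t] and data [d] on top
   of a stack; tag 0 marks the bottom. *)
Definition ev (e x K : nat) : nat := cpair 0 (cpair e (cpair x K)).
Definition ret (y K : nat) : nat := cpair 1 (cpair y K).
Definition push (t d K : nat) : nat := cpair t (cpair d K).

Definition step_ev (e x K : nat) : nat :=
  match cfst e with
  | 0 => ret 0 K
  | 1 => ret (S x) K
  | 2 => ret (cfst x) K
  | 3 => ret (csnd x) K
  | 4 => ev (cfst (csnd e)) x (push 1 (cpair (csnd (csnd e)) x) K)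
  | 5 => ev (csnd (csnd e)) x (push 3 (cfst (csnd e)) K)
  | 6 => ev (cfst (csnd e)) (cfst x)
           (push 4 (cpair (csnd (csnd e)) (cpair (cfst x) (cpair 0 (csnd x)))) K)
  | _ => ev (csnd e) (cpair x 0) (push 5 (cpair (csnd e) (cpair x 0)) K)
  end.

(* [t], [d], [K] are the tag and data of the top frame and the stack below. *)
Definition step_frame (y t d K : nat) : nat :=
  match t with
  | 0 => ret y 0
  | 1 => ev (cfst d) (csnd d) (push 2 y K)
  | 2 => ret (cpair d y) K
  | 3 => ev d y K
  | 4 =>
      match csnd (csnd (csnd d)) with
      | 0 => ret y K
      | S r =>
          ev (cfst d) (cpair (cfst (csnd d)) (cpair (cfst (csnd (csnd d))) y))
            (push 4 (cpair (cfst d) (cpair (cfst (csnd d))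
               (cpair (S (cfst (csnd (csnd d)))) r))) K)
      end
  | _ =>
      match y with
      | 0 => ret (csnd (csnd d)) K
      | S _ =>
          ev (cfst d) (cpair (cfst (csnd d)) (S (csnd (csnd d))))
            (push 5 (cpair (cfst d)
               (cpair (cfst (csnd d)) (S (csnd (csnd d))))) K)
      end
  end.

Definition step_ret (y K : nat) : nat :=
  step_frame y (cfst K) (cfst (csnd K)) (csnd (csnd K)).

Definition step (st : nat) : nat :=
  match cfst st with
  | 0 => step_ev (cfst (csnd st)) (cfst (csnd (csnd st))) (csnd (csnd (csnd st)))
  | S _ => step_ret (cfst (csnd st)) (csnd (csnd st))
  end.

Definition run (st s : nat) : nat :=
  nat_rect (fun _ => nat) st (fun _ r => step r) s.

(** The value 0 signals halting: the machine is returning a value and the remaining stack is 0. *)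
Definition pending (e x s : nat) : nat :=
  match cfst (run (ev e x 0) s) with
  | 0 => 1
  | S _ => csnd (csnd (run (ev e x 0) s))
  end.

Lemma computable_pending : computable3 pending.
Proof.
  assert (computable3 step_ev) by (unfold step_ev, ev, ret, push; computability).
  assert (computable (fun z => step_ret (cfst z) (csnd z))).
  { unfold step_ret, step_frame, ev, ret, push. computability. }
  assert (computable step).
  { unfold step. computability. }
  unfold pending, run, ev. computability.
Qed.
#[local] Hint Resolve computable_pending : computable.

Lemma run_add st s t : run st (s + t) = run (run st s) t.
Proof.
  induction t as [|t IH]; [now rewrite Nat.add_0_r|].
  rewrite Nat.add_succ_r. cbn [run nat_rect]. unfold run in IH. now rewrite IH.
Qed.

Definition reaches (st st' : nat) : Prop := exists s, run st s = st'.

Lemma reaches_refl st : reaches st st.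
Proof. now exists 0. Qed.

Lemma reaches_trans st st' st'' :
  reaches st st' -> reaches st' st'' -> reaches st st''.
Proof. intros [s <-] [t <-]. exists (s + t). apply run_add. Qed.

Lemma reaches_step st st' : reaches (step st) st' -> reaches st st'.
Proof. apply reaches_trans. now exists 1. Qed.

Lemma step_ev_eq e x K : step (ev e x K) = step_ev e x K.
Proof. unfold step, ev. now rewrite !csnd_cpair, !cfst_cpair. Qed.

Lemma step_ret_eq y t d K : step (ret y (push t d K)) = step_frame y t d K.
Proof.
  unfold step, step_ret, ret, push. now rewrite !csnd_cpair, !cfst_cpair.
Qed.

(** Induction on the program, with index and stack left general because subprograms run under pushed
    frames. *)
Lemma reaches_eval c : forall e x y K,
  decode e = c -> eval c x y -> reaches (ev e x K) (ret y K).
Proof.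
  induction c as [| | | |c1 IH1 c2 IH2|c1 IH1 c2 IH2|c1 IH1 c2 IH2|c1 IH1];
    intros e x y K He Hy; rewrite decode_eq in He; cbv zeta in He;
    apply reaches_step; rewrite step_ev_eq; unfold step_ev;
    destruct (cfst e) as [|[|[|[|[|[|[|t]]]]]]]; try discriminate He;
    cbn [eval] in Hy; try (subst y; apply reaches_refl).
  - injection He as H1 H2. destruct Hy as (u & v & Hu & Hv & ->).
    eapply reaches_trans; [apply IH1; eassumption|].
    apply reaches_step. rewrite step_ret_eq. cbn [step_frame].
    rewrite cfst_cpair, csnd_cpair.
    eapply reaches_trans; [apply IH2; eassumption|].
    apply reaches_step. rewrite step_ret_eq. apply reaches_refl.
  - injection He as H1 H2. destruct Hy as (u & Hu & Hv).
    eapply reaches_trans; [apply IH2; eassumption|].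
    apply reaches_step. rewrite step_ret_eq. cbn [step_frame].
    now apply IH1.
  - injection He as H1 H2.
    set (h := nat_rect _ _ _) in Hy.
    (* Loop invariant of [Prec]: [k] rounds are done and [r] remain. *)
    assert (H : forall k r y, h k y ->
      reaches (ev (cfst (csnd e)) (cfst x)
                 (push 4 (cpair (csnd (csnd e))
                    (cpair (cfst x) (cpair 0 (k + r)))) K))
        (ret y (push 4 (cpair (csnd (csnd e))
                    (cpair (cfst x) (cpair k r))) K))).
    { clear y Hy. induction k as [|k IH]; intros r y Hy.
      - now apply IH1.
      - destruct Hy as (u & Hu & Hy). rewrite Nat.add_succ_comm.
        eapply reaches_trans; [apply IH, Hu|].
        apply reaches_step. rewrite step_ret_eq. cbn [step_frame].
        rewrite !csnd_cpair, !cfst_cpair. now apply IH2. }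
    specialize (H (csnd x) 0 y Hy). rewrite Nat.add_0_r in H.
    eapply reaches_trans; [exact H|].
    apply reaches_step. rewrite step_ret_eq. cbn [step_frame].
    rewrite !csnd_cpair. apply reaches_refl.
  - injection He as H1. destruct Hy as [Hy Hlt].
    assert (H : forall w, w <= y ->
      reaches (ev (csnd e) (cpair x 0) (push 5 (cpair (csnd e) (cpair x 0)) K))
        (ev (csnd e) (cpair x w) (push 5 (cpair (csnd e) (cpair x w)) K))).
    { induction w as [|w IH]; intros Hw; [apply reaches_refl|].
      eapply reaches_trans; [apply IH; lia|].
      destruct (Hlt w) as [z Hz]; [lia|].
      eapply reaches_trans; [apply IH1; eassumption|].
      apply reaches_step. rewrite step_ret_eq. cbn [step_frame].
      rewrite !csnd_cpair, !cfst_cpair. apply reaches_refl. }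
    eapply reaches_trans; [apply (H y); lia|].
    eapply reaches_trans; [apply IH1; eassumption|].
    apply reaches_step. rewrite step_ret_eq. cbn [step_frame].
    rewrite !csnd_cpair. apply reaches_refl.
Qed.

(* [accepts K y]: the computation that returns [y] to [K] terminates.  Each
   constructor mirrors one case of [step_frame]. *)
Inductive accepts : nat -> nat -> Prop :=
| accepts_bottom K y : cfst K = 0 -> accepts K y
| accepts_pair1 d x K y z :
    eval (decode d) x z -> accepts K (cpair y z) ->
    accepts (push 1 (cpair d x) K) y
| accepts_pair2 u K y : accepts K (cpair u y) -> accepts (push 2 u K) y
| accepts_comp c K y z :
    eval (decode c) y z -> accepts K z -> accepts (push 3 c K) y
| accepts_prec_done d a k K y :
    accepts K y -> accepts (push 4 (cpair d (cpair a (cpair k 0))) K) y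
| accepts_prec d a k r K y z :
    eval (decode d) (cpair a (cpair k y)) z ->
    accepts (push 4 (cpair d (cpair a (cpair (S k) r))) K) z ->
    accepts (push 4 (cpair d (cpair a (cpair k (S r)))) K) y
| accepts_mu_done t c x w K :
    accepts K w -> accepts (push (5 + t) (cpair c (cpair x w)) K) 0
| accepts_mu t c x w K y z :
    eval (decode c) (cpair x (S w)) z ->
    accepts (push 5 (cpair c (cpair x (S w))) K) z ->
    accepts (push (5 + t) (cpair c (cpair x w)) K) (S y).

(** Halting described through [eval] instead of runs; soundness follows by pulling this property
    back along [step]. *)
Definition terminates (st : nat) : Prop :=
  match cfst st with
  | 0 => exists y, eval (decode (cfst (csnd st))) (cfst (csnd (csnd st))) y /\
           accepts (csnd (csnd (csnd st))) y
  | S _ => accepts (csnd (csnd st)) (cfst (csnd st))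
  end.

Lemma terminates_ev e x K :
  terminates (ev e x K) <-> exists y, eval (decode e) x y /\ accepts K y.
Proof. unfold terminates, ev. now rewrite !csnd_cpair, !cfst_cpair. Qed.

Lemma terminates_ret y K : terminates (ret y K) <-> accepts K y.
Proof. unfold terminates, ret. now rewrite !csnd_cpair, !cfst_cpair. Qed.

Lemma cpair_inj a b c d : cpair a b = cpair c d -> a = c /\ b = d.
Proof.
  intros E. split.
  - now rewrite <- (cfst_cpair a b), E, cfst_cpair.
  - now rewrite <- (csnd_cpair a b), E, csnd_cpair.
Qed.

Ltac invert_push H :=
  inversion H; clear H; unfold push in *;
  repeat match goal with
  | E : cpair _ _ = cpair _ _ |- _ => apply cpair_inj in E as []
  | E : S _ = S _ |- _ => injection E as E
  | E : cfst (cpair _ _) = _ |- _ => rewrite cfst_cpair in E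
  end; subst; try discriminate.

(** Here [h] stands for the graph of the recursion; unwinding the frame carries it through the [r]
    remaining rounds. *)
Lemma accepts_prec_inv (h : nat -> nat -> Prop) d a K :
  (forall k u z, h k u -> eval (decode d) (cpair a (cpair k u)) z -> h (S k) z) ->
  forall r k y, h k y ->
  accepts (push 4 (cpair d (cpair a (cpair k r))) K) y ->
  exists z, h (k + r) z /\ accepts K z.
Proof.
  intros Hh. induction r as [|r IH]; intros k y Hy H; invert_push H.
  - rewrite Nat.add_0_r. eauto.
  - rewrite <- Nat.add_succ_comm. eauto.
Qed.

(** The number of search rounds is not known beforehand, so the induction is on the acceptance
    derivation, with the stack generalized to [L]. *)
Lemma accepts_mu_inv c x L y :
  accepts L y -> forall w K, L = push 5 (cpair c (cpair x w)) K ->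
  eval (decode c) (cpair x w) y ->
  (forall m, m < w -> exists z, eval (decode c) (cpair x m) (S z)) ->
  exists z, eval (Mu (decode c)) x z /\ accepts K z.
Proof.
  induction 1; intros w' K' E Hw Hlt; unfold push in E;
    repeat match goal with
    | E : cpair _ _ = cpair _ _ |- _ => apply cpair_inj in E as []
    end; subst; try discriminate.
  - rewrite cfst_cpair in H. discriminate.
  - now exists w'.
  - apply (IHaccepts (S w') K'); [reflexivity|assumption|].
    intros m Hm. destruct (Nat.eq_dec m w') as [->|]; [eauto|].
    apply Hlt. lia.
Qed.

Lemma push_eta K : push (cfst K) (cfst (csnd K)) (csnd (csnd K)) = K.
Proof. unfold push. now rewrite !cpair_eta. Qed.

Lemma terminates_step_frame y t d K :
  terminates (step_frame y t d K) -> accepts (push t d K) y.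
Proof.
  (* Arbitrary frame data is expanded into nested pairs to fit the constructors of [accepts]. *)
  assert (E1 : d = cpair (cfst d) (csnd d)) by now rewrite cpair_eta.
  assert (E2 : d = cpair (cfst d) (cpair (cfst (csnd d)) (csnd (csnd d))))
    by now rewrite !cpair_eta.
  assert (E3 : d = cpair (cfst d) (cpair (cfst (csnd d))
                 (cpair (cfst (csnd (csnd d))) (csnd (csnd (csnd d))))))
    by now rewrite !cpair_eta.
  destruct t as [|[|[|[|[|t]]]]]; cbn [step_frame];
    [|replace (push 1 d K) with (push 1 (cpair (cfst d) (csnd d)) K) by congruence
     | |
     |replace (push 4 d K) with (push 4 (cpair (cfst d) (cpair (cfst (csnd d))
        (cpair (cfst (csnd (csnd d))) (csnd (csnd (csnd d)))))) K) by congruence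
     |replace (push _ d K) with (push (5 + t) (cpair (cfst d)
        (cpair (cfst (csnd d)) (csnd (csnd d)))) K) by (cbn [Nat.add]; congruence)];
    clear E1 E2 E3.
  - intros _. constructor. apply cfst_cpair.
  - rewrite terminates_ev. intros (z & Hz & H). invert_push H.
    now apply accepts_pair1 with z.
  - rewrite terminates_ret. apply accepts_pair2.
  - rewrite terminates_ev. intros (z & Hz & H). now apply accepts_comp with z.
  - destruct (csnd (csnd (csnd d))) as [|r].
    + rewrite terminates_ret. apply accepts_prec_done.
    + rewrite terminates_ev. intros (z & Hz & H). now apply accepts_prec with z.
  - destruct y as [|y].
    + rewrite terminates_ret. apply accepts_mu_done.
    + rewrite terminates_ev. intros (z & Hz & H). now apply accepts_mu with z.
Qed.

Lemma terminates_step st : terminates (step st) -> terminates st.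
Proof.
  unfold step. unfold terminates at 2. destruct (cfst st).
  2:{ intros H. apply terminates_step_frame in H. now rewrite push_eta in H. }
  generalize (cfst (csnd st)) as e, (cfst (csnd (csnd st))) as x,
    (csnd (csnd (csnd st))) as K.
  intros e x K. rewrite decode_eq. unfold step_ev. cbv zeta.
  destruct (cfst e) as [|[|[|[|[|[|[|t]]]]]]];
    rewrite ?terminates_ret, ?terminates_ev; cbn [eval]; eauto.
  - intros (u & Hu & H). invert_push H. eauto 8.
  - intros (u & Hu & H). invert_push H. eauto 8.
  - intros (u & Hu & H). set (h := nat_rect _ _ _).
    apply (accepts_prec_inv h) with (k := 0) in H; [exact H| |exact Hu].
    cbn [h nat_rect]. eauto.
  - intros (u & Hu & H). eapply accepts_mu_inv in H; eauto. lia.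
Qed.

(** The empty stack 0 has tag 0, so a halted machine keeps returning the same value to the empty
    stack. *)
Lemma pending_mono e x s t : s <= t -> pending e x s = 0 -> pending e x t = 0.
Proof.
  intros Hst. replace t with (s + (t - s)) by lia.
  generalize (t - s) as r. clear t Hst. intros r. unfold pending.
  rewrite run_add. generalize (run (ev e x 0) s) as st. intros st.
  destruct (cfst st) as [|k] eqn:E; [discriminate|]. intros Hst.
  enough (run st r = st \/ run st r = ret (cfst (csnd st)) 0) as [->| ->].
  { now rewrite E. }
  { unfold ret. now rewrite cfst_cpair, !csnd_cpair. }
  induction r as [|r IH]; [now left|]. right. cbn [run nat_rect].
  fold (run st r).
  destruct IH as [->| ->].
  - unfold step. rewrite E, Hst. reflexivity.
  - unfold step, ret. now rewrite cfst_cpair, !csnd_cpair, cfst_cpair.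
Qed.

Lemma W_pending e x : W e x <-> exists s, pending e x s = 0.
Proof.
  split.
  - intros [y Hy]. destruct (reaches_eval _ e x y 0 eq_refl Hy) as [s Hs].
    exists s. unfold pending. rewrite Hs. unfold ret.
    now rewrite cfst_cpair, !csnd_cpair.
  - intros [s Hs].
    (* The property holds at the halted state and is then pulled back step by step to the initial
       one. *)
    assert (H : terminates (run (ev e x 0) s)).
    { unfold pending in Hs. unfold terminates.
      destruct (cfst (run (ev e x 0) s)); [discriminate|].
      rewrite Hs. now constructor. }
    clear Hs. induction s as [|s IH].
    + apply terminates_ev in H as (y & Hy & _). now exists y.
    + apply IH, terminates_step, H.
Qed.

(** * Parameters and recursion *)

(** An index of the constant function [a], iterating [Comp Succ] (tag 5). *)
Definition numeral (a : nat) : nat :=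
  nat_rect (fun _ => nat) (encode Zero)
    (fun _ r => cpair 5 (cpair (encode Succ) r)) a.

Lemma eval_numeral a x y : eval (decode (numeral a)) x y <-> y = a.
Proof.
  revert y. induction a as [|a IH]; intros y; cbn [numeral nat_rect].
  - rewrite decode_encode. reflexivity.
  - rewrite decode_eq. cbv zeta. rewrite !csnd_cpair, !cfst_cpair, decode_encode.
    fold (numeral a). cbn [eval]. split.
    + intros (u & Hu & ->). now apply IH in Hu as ->.
    + intros ->. exists a. now rewrite IH.
Qed.

(** The tags 5 and 4 are [Comp] and [Pair], and [Pair Fst Snd] is the identity: [e] is run on the
    pair of [a] and the input. *)
Definition smn (e a : nat) : nat :=
  cpair 5 (cpair e (cpair 4 (cpair (numeral a) (encode (Pair Fst Snd))))).

Lemma eval_smn e a x y :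
  eval (decode (smn e a)) x y <-> eval (decode e) (cpair a x) y.
Proof.
  unfold smn. rewrite decode_eq. cbv zeta.
  rewrite !csnd_cpair, !cfst_cpair, (decode_eq (cpair 4 _)). cbv zeta.
  rewrite !csnd_cpair, !cfst_cpair, decode_encode. cbn [eval]. split.
  - intros (u & (v & w & Hv & (? & ? & -> & -> & ->) & ->) & H).
    apply eval_numeral in Hv as ->. now rewrite cpair_eta in H.
  - intros H. exists (cpair a x). split; [|exact H]. exists a, x.
    rewrite eval_numeral. repeat split.
    exists (cfst x), (csnd x). now rewrite cpair_eta.
Qed.

Lemma computable_smn : computable (fun z => smn (cfst z) (csnd z)).
Proof. unfold smn, numeral. computability. Qed.
#[local] Hint Resolve computable_smn : computable.

Lemma eval_functional c : forall x y y', eval c x y -> eval c x y' -> y = y'.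
Proof.
  induction c as [| | | |c1 IH1 c2 IH2|c1 IH1 c2 IH2|c1 IH1 c2 IH2|c1 IH1];
    intros x y y'; cbn [eval]; try congruence.
  - intros (u & v & Hu & Hv & ->) (u' & v' & Hu' & Hv' & ->).
    now rewrite (IH1 _ _ _ Hu Hu'), (IH2 _ _ _ Hv Hv').
  - intros (u & Hu & H) (u' & Hu' & H'). rewrite (IH2 _ _ _ Hu Hu') in H. eauto.
  - revert y y'. induction (csnd x) as [|k IH]; intros y y'; cbn [nat_rect]; eauto.
    intros (u & Hu & H) (u' & Hu' & H'). rewrite (IH _ _ Hu Hu') in H. eauto.
  - intros [H Hlt] [H' Hlt'].
    destruct (Nat.lt_trichotomy y y') as [L|[L|L]]; [|exact L|].
    + destruct (Hlt' _ L) as [z Hz]. discriminate (IH1 _ _ _ H Hz).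
    + destruct (Hlt _ L) as [z Hz]. discriminate (IH1 _ _ _ H' Hz).
Qed.

Lemma least_zero (g : nat -> nat) s :
  g s = 0 -> exists m, g m = 0 /\ forall k, k < m -> g k <> 0.
Proof.
  induction s as [s IH] using lt_wf_ind. intros Hs.
  destruct (classic (exists k, k < s /\ g k = 0)) as [(k & Hk & E)|N].
  - eauto.
  - exists s. split; [exact Hs|]. intros k Hk E. eauto.
Qed.

Lemma semidecidable_index q : computable3 q ->
  exists v, forall p z, W (smn v p) z <-> exists s, q p z s = 0.
Proof.
  intros [c Hc]. exists (encode (Mu c)). intros p z. unfold W.
  assert (Hq : forall s, eval c (cpair (cpair p z) s) (q p z s)).
  { intros s. specialize (Hc (cpair (cpair p z) s)). cbv beta in Hc.
    now rewrite !csnd_cpair, !cfst_cpair, csnd_cpair in Hc. }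
  split.
  - intros [y Hy]. apply eval_smn in Hy. rewrite decode_encode in Hy.
    exists y. exact (eval_functional _ _ _ _ (Hq y) (proj1 Hy)).
  (* [Mu] demands nonzero values before its result, hence the least zero. *)
  - intros [s Hs]. apply least_zero in Hs as (m & Hm & Hlt). exists m.
    apply eval_smn. rewrite decode_encode. split; [now rewrite <- Hm|].
    intros k Hk. exists (pred (q p z k)).
    rewrite Nat.succ_pred by now apply Hlt. apply Hq.
Qed.

Lemma uniform_index q : computable3 q ->
  exists h, computable h /\
    forall p z, W (h p) z <-> exists s, q p z s = 0.
Proof.
  intros [v Hv]%semidecidable_index. exists (fun p => smn v p).
  split; [computability | exact Hv].
Qed.

(** Kleene's diagonal argument: the parameter is replaced by [smn p p], and the resulting index is
    applied to itself. *)
Lemma recursion_theorem q : computable3 q ->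
  exists e, forall z, W e z <-> exists s, q e z s = 0.
Proof.
  intros Hq.
  destruct (semidecidable_index (fun p z s => q (smn p p) z s)) as [v Hv];
    [computability|].
  exists (smn v v). apply Hv.
Qed.

(** * Columns and their tails *)

Definition full (n : nat) (A : nat -> Prop) (c : nat) : Prop :=
  c < n /\ forall x, A (cpair c x).

(* The columns from [n] on are compared without removing an initial segment:
   there the gap is 0 by convention. *)
Definition first_gap (n : nat) (A : nat -> Prop) (c k : nat) : Prop :=
  (forall y, y < k -> A (cpair c y)) /\
  (c < n -> ~ A (cpair c k)) /\
  (n <= c -> k = 0).

(* Vacuously true on full columns, which have no gap. *)
Definition tail (n : nat) (A : nat -> Prop) (c x : nat) : Prop :=
  forall k, first_gap n A c k -> A (cpair c (x + k)).

Definition tail_eq (n i j : nat) : Prop :=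
  forall c x, tail n (W i) c x <-> tail n (W j) c x.

Lemma first_gap_unique n A c k l :
  first_gap n A c k -> first_gap n A c l -> k = l.
Proof.
  intros (H1 & H2 & H3) (H1' & H2' & H3').
  destruct (le_lt_dec n c) as [Hc|Hc]; [rewrite H3, H3'; auto|].
  destruct (Nat.lt_trichotomy k l) as [L|[L|L]]; [|exact L|].
  - destruct (H2 Hc). now apply H1'.
  - destruct (H2' Hc). now apply H1.
Qed.

Lemma first_gap_exists n A c : ~ full n A c -> exists k, first_gap n A c k.
Proof.
  intros N. destruct (le_lt_dec n c) as [Hc|Hc].
  - exists 0. repeat split; lia.
  - apply NNPP. intros M. apply N. split; [exact Hc|].
    intros x. induction x as [x IH] using lt_wf_ind. apply NNPP. intros Hx.
    apply M. exists x. repeat split; [exact IH|now intros|lia].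
Qed.

Lemma tail_gap n A c k x :
  first_gap n A c k -> (tail n A c x <-> A (cpair c (x + k))).
Proof.
  intros Hk. split; [now intros H; apply H|].
  intros H l Hl. now rewrite (first_gap_unique _ _ _ _ _ Hl Hk).
Qed.

Lemma tail_of_full n A c x : full n A c -> tail n A c x.
Proof. intros [_ H] k _. apply H. Qed.

(** A tail starts at a gap, so it can contain 0 only when there is no gap. Thus the tails determine
    which columns are full. *)
Lemma full_of_tail n A c : c < n -> tail n A c 0 -> full n A c.
Proof.
  intros Hc H. apply NNPP. intros N.
  destruct (first_gap_exists _ _ _ N) as [k Hk].
  apply (proj1 (proj2 Hk) Hc), H, Hk.
Qed.

Lemma tail_unslid n A c x : n <= c -> (tail n A c x <-> A (cpair c x)).
Proof.
  intros Hc. rewrite (tail_gap n A c 0), Nat.add_0_r; [reflexivity|].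
  repeat split; lia.
Qed.

Lemma tail_ext n A B c x :
  (forall y, A (cpair c y) <-> B (cpair c y)) ->
  tail n A c x <-> tail n B c x.
Proof.
  intros E. unfold tail, first_gap. setoid_rewrite E. reflexivity.
Qed.

Lemma tail_succ n A c x : c <> n -> (tail (S n) A c x <-> tail n A c x).
Proof.
  intros Hc. unfold tail, first_gap.
  assert (E1 : c < S n <-> c < n) by lia.
  assert (E2 : S n <= c <-> n <= c) by lia.
  setoid_rewrite E1. setoid_rewrite E2. reflexivity.
Qed.

Lemma tail_eq_of_eq_ce n i j : eq_ce i j -> tail_eq n i j.
Proof. intros E c x. apply tail_ext. intros y. apply E. Qed.

Lemma tail_eq_equivalence n : Equivalence (tail_eq n).
Proof.
  split; unfold tail_eq.
  - intros i c x. reflexivity.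
  - intros i j H c x. now rewrite H.
  - intros i j k H H' c x. now rewrite H, H'.
Qed.

(** * Stagewise approximation of gaps and tails *)

Definition lead (c i s : nat) : nat :=
  nat_rect (fun _ => nat) 0
    (fun _ r => match pending i (cpair c r) s with 0 => S r | S _ => r end) s.

Definition gap_at (n c i s : nat) : nat :=
  match n - c with 0 => 0 | S _ => lead c i s end.

Lemma computable_lead : computable3 lead.
Proof. unfold lead. computability. Qed.
#[local] Hint Resolve computable_lead : computable.

Lemma computable_gap_at n : computable3 (gap_at n).
Proof. unfold gap_at. computability. Qed.
#[local] Hint Resolve computable_gap_at : computable.

Lemma lead_sound c i s x : x < lead c i s -> W i (cpair c x).
Proof.
  unfold lead. generalize s at 2 as m. induction m as [|m IH]; cbn [nat_rect].
  - lia.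
  - set (r := nat_rect _ _ _ m) in *.
    destruct (pending i (cpair c r) s) eqn:E; [|exact IH].
    intros Hx. destruct (Nat.eq_dec x r) as [->|]; [|apply IH; lia].
    apply W_pending. eauto.
Qed.

Lemma lead_complete c i k :
  (forall x, x < k -> W i (cpair c x)) ->
  exists s0, forall s, s0 <= s -> k <= lead c i s.
Proof.
  intros H.
  assert (Hs : exists s0, forall x, x < k -> pending i (cpair c x) s0 = 0).
  { induction k as [|k IH]; [exists 0; lia|].
    destruct IH as [s0 Hs0]; [auto|].
    destruct (proj1 (W_pending _ _) (H k (Nat.lt_succ_diag_r k))) as [s1 Hs1].
    exists (s0 + s1). intros x Hx. destruct (Nat.eq_dec x k) as [->|].
    - apply pending_mono with s1; [lia|exact Hs1].
    - apply pending_mono with s0; [lia|]. apply Hs0. lia. }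
  (* By stage [s0] all [k] elements have appeared; counting them takes [k] rounds. *)
  destruct Hs as [s0 Hs0]. exists (s0 + k). intros s Hs.
  enough (E : forall m, Nat.min k m <= nat_rect (fun _ => nat) 0
    (fun _ r => match pending i (cpair c r) s with 0 => S r | S _ => r end) m).
  { specialize (E s). unfold lead. lia. }
  induction m as [|m IH]; cbn [nat_rect]; [lia|].
  set (r := nat_rect _ _ _ m) in *.
  destruct (le_lt_dec k r) as [Hr|Hr].
  - destruct (pending i (cpair c r) s); lia.
  - rewrite (pending_mono _ _ s0 s); [lia|lia|auto].
Qed.

Lemma gap_at_limit n i c k :
  first_gap n (W i) c k -> exists s0, forall s, s0 <= s -> gap_at n c i s = k.
Proof.
  intros (H1 & H2 & H3). unfold gap_at.
  destruct (n - c) eqn:E; [exists 0; intros; symmetry; apply H3; lia|].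
  destruct (lead_complete c i k H1) as [s0 Hs0]. exists s0. intros s Hs.
  apply Nat.le_antisymm; [|auto].
  apply Nat.nlt_ge. intros L. apply lead_sound in L. now apply H2; [lia|].
Qed.

(** On a full column the approximate gap need not converge, but there every shift gives the correct
    answer. *)
Lemma tail_limit n i c :
  exists s0, forall s, s0 <= s -> forall x,
    W i (cpair c (x + gap_at n c i s)) <-> tail n (W i) c x.
Proof.
  destruct (classic (full n (W i) c)) as [F|N].
  - exists 0. intros s _ x. split; [now intros; apply tail_of_full|].
    intros _. apply F.
  - apply first_gap_exists in N as [k Hk].
    destruct (gap_at_limit _ _ _ _ Hk) as [s0 Hs0]. exists s0. intros s Hs x.
    rewrite (Hs0 s Hs). symmetry. now apply tail_gap.
Qed.

(** Once the gap has settled, membership of a single element is decided in the limit. On a full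
    column the growing gap could outrun the enumeration, which is why fullness is excluded. *)
Lemma tail_limit_pending n i c x :
  ~ full n (W i) c -> exists s0, forall s, s0 <= s ->
    (pending i (cpair c (x + gap_at n c i s)) s = 0 <-> tail n (W i) c x).
Proof.
  intros N. apply first_gap_exists in N as [k Hk].
  destruct (gap_at_limit _ _ _ _ Hk) as [s0 Hs0].
  destruct (classic (W i (cpair c (x + k)))) as [H|H].
  - assert (H' := H). apply W_pending in H' as [s1 Hs1]. exists (s0 + s1).
    intros s Hs. rewrite (Hs0 s) by lia. rewrite (tail_gap _ _ _ _ _ Hk).
    split; [now intros|]. intros _. apply pending_mono with s1; [lia|exact Hs1].
  - exists s0. intros s Hs. rewrite (Hs0 s) by lia.
    rewrite (tail_gap _ _ _ _ _ Hk), W_pending. split; [eauto|].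
    rewrite <- W_pending. contradiction.
Qed.

(** * Enumerability in indices *)

(** The relation that slides column [c] alone; [tail_eq] is built up by composing such slides. *)
Definition slide_eq (c i j : nat) : Prop :=
  (forall x, tail (S c) (W i) c x <-> tail (S c) (W j) c x) /\
  forall d x, d <> c -> (W i (cpair d x) <-> W j (cpair d x)).

Lemma tail_eq_succ n i j : tail_eq (S n) i j <->
  exists j', tail_eq n i j' /\ slide_eq n j' j.
Proof.
  split.
  - intros H.
    (* The intermediate set takes column [n] from [i] and all others from [j]; the sum of the two
       truncated differences is 0 exactly on column [n]. *)
    destruct (uniform_index (fun p z s =>
      match (cfst z - n) + (n - cfst z) with
      | 0 => pending (cfst p) z s
      | S _ => pending (csnd p) z s
      end)) as (h & _ & Hh); [computability|].
    assert (Hn : forall x, W (h (cpair i j)) (cpair n x) <-> W i (cpair n x)).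
    { intros x. rewrite Hh, !cfst_cpair, Nat.sub_diag. cbn [Nat.add].
      now rewrite <- W_pending. }
    assert (Hd : forall d x, d <> n ->
              (W (h (cpair i j)) (cpair d x) <-> W j (cpair d x))).
    { intros d x Hd. rewrite Hh, !cfst_cpair, csnd_cpair.
      destruct ((d - n) + (n - d)) eqn:E; [lia|]. now rewrite <- W_pending. }
    exists (h (cpair i j)). split; [|split].
    + intros c x. destruct (Nat.eq_dec c n) as [->|Hc].
      * apply tail_ext. intros y. now rewrite Hn.
      * rewrite <- (tail_succ n (W i)), (H c x), tail_succ by assumption.
        apply tail_ext. intros y. now rewrite Hd.
    + intros x. rewrite <- (H n x). apply tail_ext, Hn.
    + exact Hd.
  - intros (j' & H & Hn & Hd) c x. destruct (Nat.eq_dec c n) as [->|Hc].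
    + rewrite <- Hn. apply tail_ext. intros y.
      rewrite <- !(tail_unslid n _ n) by lia. apply H.
    + rewrite !tail_succ by assumption. rewrite (H c x).
      apply tail_ext. intros y. now apply Hd.
Qed.

Lemma slide_eq_enumerable c :
  exists beta, computable2 beta /\
    forall i j, slide_eq c i j <-> exists m, eq_ce (beta i m) j.
Proof.
  (* With [m] coding [l], [k], [s], this is the minimum of [k] and the lead at stage [s]: only
     elements already seen are cut off, so no gap is lost. *)
  set (g i m := cfst (csnd m) - (cfst (csnd m) - lead c i (csnd (csnd m)))).
  assert (Hg : computable (fun z => g (cfst z) (csnd z))).
  { unfold g. computability. }
  (* In column [c], [g] initial elements are removed and [l] new ones are put in front;
     [S (csnd z) - l] vanishes exactly on the new ones. *)
  destruct (uniform_index (fun p z s =>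
    match (cfst z - c) + (c - cfst z) with
    | 0 =>
        match S (csnd z) - cfst (csnd p) with
        | 0 => 0
        | S x => pending (cfst p) (cpair c (x + g (cfst p) (csnd p))) s
        end
    | S _ => pending (cfst p) z s
    end)) as (h & Hh & HW); [computability|].
  assert (Hd : forall i m d x, d <> c ->
    (W (h (cpair i m)) (cpair d x) <-> W i (cpair d x))).
  { intros i m d x Hd. rewrite HW, !cfst_cpair.
    destruct ((d - c) + (c - d)) eqn:E; [lia|]. now rewrite <- W_pending. }
  assert (Hlt : forall i m x, x < cfst m -> W (h (cpair i m)) (cpair c x)).
  { intros i m x Hx. rewrite HW, !cfst_cpair, !csnd_cpair, Nat.sub_diag. cbn [Nat.add].
    exists 0. now replace (S x - cfst m) with 0 by lia. }
  assert (Hge : forall i m x,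
    W (h (cpair i m)) (cpair c (x + cfst m)) <-> W i (cpair c (x + g i m))).
  { intros i m x. rewrite HW, !cfst_cpair, !csnd_cpair, Nat.sub_diag. cbn [Nat.add].
    replace (S (x + cfst m) - cfst m) with (S x) by lia.
    now rewrite <- W_pending. }
  assert (Hgl : forall i m x, x < g i m -> W i (cpair c x)).
  { intros i m x Hx. apply (lead_sound c i (csnd (csnd m))). unfold g in Hx. lia. }
  exists (fun i m => h (cpair i m)). split; [computability|]. intros i j. split.
  - intros [Ht Hne].
    (* The shifts are the first gaps of the two columns, or 0 when both are full. *)
    assert (E : exists k l, (forall x, x < k -> W i (cpair c x)) /\
      (forall x, x < l -> W j (cpair c x)) /\
      forall x, W i (cpair c (x + k)) <-> W j (cpair c (x + l))).
    { destruct (classic (full (S c) (W i) c)) as [F|N].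
      - assert (F' : full (S c) (W j) c).
        { apply full_of_tail; [lia|]. now apply Ht, tail_of_full. }
        exists 0, 0. repeat split; intros; try lia; apply F || apply F'.
      - assert (N' : ~ full (S c) (W j) c).
        { intros F. apply N, full_of_tail; [lia|]. now apply Ht, tail_of_full. }
        apply first_gap_exists in N as [k Hk], N' as [l Hl]. exists k, l.
        split; [apply Hk|]. split; [apply Hl|]. intros x.
        now rewrite <- (tail_gap _ _ _ _ _ Hk), Ht, (tail_gap _ _ _ _ _ Hl). }
    destruct E as (k & l & Hk & Hl & E).
    destruct (lead_complete c i k Hk) as [s Hs]. specialize (Hs s (le_n s)).
    exists (cpair l (cpair k s)). intros z. rewrite <- (cpair_eta z).
    destruct (Nat.eq_dec (cfst z) c) as [->|Hz].
    + destruct (le_lt_dec l (csnd z)) as [L|L].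
      * replace (csnd z) with (csnd z - l + l) by lia.
        rewrite <- E.
        specialize (Hge i (cpair l (cpair k s)) (csnd z - l)).
        unfold g in Hge. rewrite !csnd_cpair, !cfst_cpair in Hge. rewrite Hge.
        now replace (k - (k - lead c i s)) with k by lia.
      * split; [now intros; apply Hl|]. intros _. apply Hlt.
        now rewrite cfst_cpair.
    + rewrite Hd by assumption. now apply Hne.
  - intros [m Hm]. set (l := cfst m) in *.
    assert (Ej : forall x, tail (S c) (W j) c x <->
                           tail (S c) (W (h (cpair i m))) c x).
    { intros x. apply tail_ext. intros y. symmetry. apply Hm. }
    split; [|intros d x Hdc; rewrite <- (Hm (cpair d x)); symmetry; now apply Hd].
    intros x. rewrite Ej. clear Ej.
    destruct (classic (full (S c) (W i) c)) as [F|N].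
    + split; intros _; apply tail_of_full; [|exact F]. split; [lia|].
      intros y. destruct (le_lt_dec l y) as [L|L]; [|now apply Hlt].
      replace y with (y - l + l) by lia. apply Hge, F.
    + apply first_gap_exists in N as [k Hk].
      assert (Hgk : g i m <= k).
      { apply Nat.nlt_ge. intros L. apply Hgl in L. now apply Hk in L; [|lia]. }
      (* Cutting and padding only move the first gap, so the tail behind it is unchanged. *)
      assert (Hk' : first_gap (S c) (W (h (cpair i m))) c (k - g i m + l)).
      { split; [|split; [|lia]].
        - intros y Hy. destruct (le_lt_dec l y) as [L|L]; [|now apply Hlt].
          replace y with (y - l + l) by lia. apply Hge, Hk. lia.
        - intros _ H. apply Hge in H. apply Hk; [lia|].
          now replace (k - g i m + g i m) with k in H by lia. }
      rewrite (tail_gap _ _ _ _ _ Hk), (tail_gap _ _ _ _ _ Hk').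
      rewrite Nat.add_assoc. unfold l. rewrite Hge.
      now replace (x + (k - g i m) + g i m) with (x + k) by lia.
Qed.

(** For [n = 0] this is equality; each further column composes the previous listing with the listing
    of slides. *)
Lemma tail_eq_enumerable n : enumerable_in_indices (tail_eq n).
Proof.
  split; [apply tail_eq_of_eq_ce|].
  induction n as [|n (alpha & Ha & IH)].
  - exists (fun i _ => i). split; [computability|].
    intros i j. split.
    + intros H. exists 0. intros z. rewrite <- (cpair_eta z).
      rewrite <- !(tail_unslid 0) by lia. apply H.
    + intros [_ H]. now apply tail_eq_of_eq_ce.
  - destruct (slide_eq_enumerable n) as (beta & Hb & HB).
    exists (fun i m => beta (alpha i (cfst m)) (csnd m)).
    split; [computability|]. intros i j. rewrite tail_eq_succ. split.
    + intros (j' & H & [Ht Hd]). apply IH in H as [m Hm].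
      destruct (proj1 (HB (alpha i m) j)) as [m' Hm'].
      * split.
        -- intros x. rewrite <- Ht. apply tail_ext. intros y. apply Hm.
        -- intros d x Hdn. now rewrite <- Hd, (Hm (cpair d x)).
      * exists (cpair m m'). now rewrite cfst_cpair, csnd_cpair.
    + intros [m Hm]. exists (alpha i (cfst m)). split.
      * apply IH. exists (cfst m). intros z. reflexivity.
      * apply HB. eauto.
Qed.

(** * Reductions *)

(** The set is copied into every column from [n] on, where columns are compared exactly; the columns
    below [n] stay empty. *)
Lemma eq_ce_reducible_tail_eq n : reducible eq_ce (tail_eq n).
Proof.
  destruct (uniform_index (fun p z s =>
    match n - cfst z with 0 => pending p (csnd z) s | S _ => 1 end))
    as (h & Hh & HW); [computability|].
  assert (Hlt : forall i c x, c < n -> ~ W (h i) (cpair c x)).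
  { intros i c x Hc. rewrite HW, cfst_cpair. intros [s Hs].
    destruct (n - c) eqn:E; [lia|discriminate]. }
  assert (Hge : forall i c x, n <= c -> (W (h i) (cpair c x) <-> W i x)).
  { intros i c x Hc. rewrite HW, cfst_cpair, csnd_cpair.
    replace (n - c) with 0 by lia. now rewrite <- W_pending. }
  exists h. split; [exact Hh|]. intros i j. split.
  - intros E. apply tail_eq_of_eq_ce. intros z. rewrite <- (cpair_eta z).
    destruct (le_lt_dec n (cfst z)) as [L|L].
    + rewrite !Hge by assumption. apply E.
    + split; intros H; now apply Hlt in H.
  - intros H x. specialize (H n x). now rewrite !tail_unslid, !Hge in H by lia.
Qed.

(** An empty column is inserted at position [n], so the additional sliding column carries no
    information. *)
Lemma tail_eq_reducible_succ n : reducible (tail_eq n) (tail_eq (S n)).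
Proof.
  destruct (uniform_index (fun p z s =>
    match n - cfst z with
    | 0 => match cfst z - n with
           | 0 => 1
           | S _ => pending p (cpair (cfst z - 1) (csnd z)) s
           end
    | S _ => pending p z s
    end)) as (h & Hh & HW); [computability|].
  assert (Hlt : forall i c x, c < n -> (W (h i) (cpair c x) <-> W i (cpair c x))).
  { intros i c x Hc. rewrite HW, cfst_cpair.
    destruct (n - c) eqn:E; [lia|]. now rewrite <- W_pending. }
  assert (Hn : forall i x, ~ W (h i) (cpair n x)).
  { intros i x. rewrite HW, cfst_cpair, Nat.sub_diag. now intros []. }
  assert (Hge : forall i c x, n <= c ->
            (W (h i) (cpair (S c) x) <-> W i (cpair c x))).
  { intros i c x Hc. rewrite HW, cfst_cpair, csnd_cpair.
    replace (n - S c) with 0 by lia. destruct (S c - n) eqn:E; [lia|].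
    rewrite Nat.sub_succ, Nat.sub_0_r. now rewrite <- W_pending. }
  assert (Tlt : forall i c x, c < n ->
            (tail (S n) (W (h i)) c x <-> tail n (W i) c x)).
  { intros i c x Hc. rewrite tail_succ by lia. apply tail_ext. intros y.
    now apply Hlt. }
  assert (Tge : forall i c x, n <= c ->
            (tail (S n) (W (h i)) (S c) x <-> tail n (W i) c x)).
  { intros i c x Hc. rewrite !tail_unslid by lia. now apply Hge. }
  exists h. split; [exact Hh|]. intros i j. split; intros H c x.
  - destruct (Nat.lt_trichotomy c n) as [L|[->|L]].
    + rewrite !Tlt by assumption. apply H.
    + apply tail_ext. intros y. split; intros Hy; now apply Hn in Hy.
    + destruct c as [|c]; [lia|]. rewrite !Tge by lia. apply H.
  - destruct (le_lt_dec n c) as [L|L].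
    + rewrite <- !Tge by assumption. apply H.
    + rewrite <- !Tlt by assumption. apply H.
Qed.

Lemma bounded_choice (P : nat -> nat -> Prop) n :
  (forall c, c < n -> exists s0, forall s, s0 <= s -> P c s) ->
  exists s0, forall c s, c < n -> s0 <= s -> P c s.
Proof.
  induction n as [|n IH]; intros H; [exists 0; lia|].
  destruct IH as [s0 H0]; [auto|]. destruct (H n) as [s1 H1]; [lia|].
  exists (s0 + s1). intros c s Hc Hs.
  destruct (Nat.eq_dec c n) as [->|]; [apply H1|apply H0]; lia.
Qed.

(** The element coding [c], [x], [s] records whether [x] lies in the tail of column [c] according to
    the gap at stage [s]. Requiring [c] and [x] to be at most [s] leaves finitely many elements per
    stage. *)
Lemma tail_eq_reducible_E0 n : reducible (tail_eq n) E0_ce.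
Proof.
  destruct (uniform_index (fun p z s =>
    match (cfst (cfst z) - csnd z) + (csnd (cfst z) - csnd z) with
    | 0 => pending p (cpair (cfst (cfst z))
             (csnd (cfst z) + gap_at n (cfst (cfst z)) p (csnd z))) s
    | S _ => 1
    end)) as (h & Hh & HW); [computability|].
  assert (Hle : forall i c x s, c <= s -> x <= s ->
    (W (h i) (cpair (cpair c x) s) <-> W i (cpair c (x + gap_at n c i s)))).
  { intros i c x s Hc Hx. rewrite HW, !cfst_cpair, !csnd_cpair.
    replace ((c - s) + (x - s)) with 0 by lia. now rewrite <- W_pending. }
  assert (Hgt : forall i c x s, s < c \/ s < x ->
    ~ W (h i) (cpair (cpair c x) s)).
  { intros i c x s H. rewrite HW, !cfst_cpair, !csnd_cpair.
    destruct ((c - s) + (x - s)) eqn:E; [lia|]. now intros []. }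
  exists h. split; [exact Hh|]. intros i j. split.
  - intros H.
    (* Only the columns below [n] need a common stage of agreement; elsewhere the gap is always
       0. *)
    destruct (bounded_choice (fun c s => forall x,
      W i (cpair c (x + gap_at n c i s)) <-> W j (cpair c (x + gap_at n c j s))) n)
      as [s0 Hs0].
    { intros c _. destruct (tail_limit n i c) as [s1 H1].
      destruct (tail_limit n j c) as [s2 H2]. exists (s1 + s2). intros s Hs x.
      rewrite H1, H2 by lia. apply H. }
    exists (map (fun w => cpair (cpair (fst (fst w)) (snd (fst w))) (snd w))
              (list_prod (list_prod (seq 0 s0) (seq 0 s0)) (seq 0 s0))).
    intros z. rewrite <- (cpair_eta z), <- (cpair_eta (cfst z)).
    generalize (cfst (cfst z)) as c, (csnd (cfst z)) as x, (csnd z) as s.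
    clear z. intros c x s Hz.
    apply in_map_iff. exists ((c, x), s). split; [reflexivity|].
    assert (Hc : c <= s /\ x <= s).
    { destruct (le_lt_dec c s) as [L|L], (le_lt_dec x s) as [L'|L']; auto;
        exfalso; destruct Hz as [[Hz _]|[Hz _]]; apply Hgt in Hz; auto. }
    rewrite !Hle in Hz by lia.
    enough (s < s0) by (rewrite !in_prod_iff, !in_seq; lia).
    apply Nat.nle_gt. intros L.
    enough (W i (cpair c (x + gap_at n c i s)) <->
            W j (cpair c (x + gap_at n c j s))) by tauto.
    destruct (le_lt_dec n c) as [Lc|Lc]; [|now apply Hs0].
    unfold gap_at. replace (n - c) with 0 by lia. rewrite Nat.add_0_r.
    rewrite <- !(tail_unslid n) by assumption. apply H.
  - intros [l Hl] c x.
    destruct (tail_limit n i c) as [s1 H1], (tail_limit n j c) as [s2 H2].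
    (* Late enough for both limits, above [c] and [x], and too large for the coded element to occur
       in [l]. *)
    set (s := s1 + s2 + c + x + S (list_max l)).
    rewrite <- (H1 s), <- (H2 s), <- !Hle by lia.
    destruct (classic (In (cpair (cpair c x) s) l)) as [I|N].
    + assert (L := proj1 (list_max_le l _) (le_n _)).
      rewrite Forall_forall in L. apply L in I.
      pose proof (cpair_le (cpair c x) s). lia.
    + specialize (Hl (cpair (cpair c x) s)). tauto.
Qed.

(** * Non-reducibility *)

(* By the recursion theorem the program [e] enlarges column [t] each time [q]
   fires on [f e], so that [e] belongs to the class of [i1] if [q] fires
   infinitely often, and to that of [i0] otherwise. *)
Lemma limit_obstruction n t f q i0 i1 :
  computable f -> computable3 q -> t <= n ->
  (forall x y, tail_eq (S n) x y -> tail_eq n (f x) (f y)) ->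
  (forall z, W i0 z <-> cfst z < t) ->
  (forall z, W i1 z <-> cfst z < S t) ->
  (forall u, tail_eq n u (f i0) ->
     forall x, exists y s, x <= y /\ q u y s = 0) ->
  (forall u, tail_eq n u (f i1) ->
     exists x, forall y s, x <= y -> q u y s <> 0) ->
  False.
Proof.
  intros Hf Hq Htn Hred H0 H1 Q0 Q1.
  (* Columns below [t] are complete and those beyond [t] empty; [x] enters column [t] once [q] fires
     at some [y >= x], with [s] coding [y] and its stage. *)
  destruct (recursion_theorem (fun e z s =>
    match t - cfst z with
    | 0 => (cfst z - t) + (csnd z - cfst s) + q (f e) (cfst s) (csnd s)
    | S _ => 0
    end)) as [e He]; [computability|].
  assert (Hlt : forall c x, c < t -> W e (cpair c x)).
  { intros c x Hc. apply He. exists 0. rewrite cfst_cpair.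
    destruct (t - c) eqn:E; [lia|reflexivity]. }
  assert (Hgt : forall c x, t < c -> ~ W e (cpair c x)).
  { intros c x Hc. rewrite He, cfst_cpair. intros [s Hs].
    replace (t - c) with 0 in Hs by lia. lia. }
  assert (Ht : forall x, W e (cpair t x) <->
            exists y s, x <= y /\ q (f e) y s = 0).
  { intros x. rewrite He, cfst_cpair, csnd_cpair, Nat.sub_diag. split.
    - intros [s Hs]. exists (cfst s), (csnd s). lia.
    - intros (y & s & L & E). exists (cpair y s).
      rewrite cfst_cpair, csnd_cpair. lia. }
  destruct (classic (forall x, W e (cpair t x))) as [F|N].
  - destruct (Q1 (f e)) as [x Hx].
    { apply Hred, tail_eq_of_eq_ce. intros z. rewrite H1, <- (cpair_eta z) at 1.
      destruct (Nat.lt_trichotomy (cfst z) t) as [L|[L|L]].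
      - split; [lia|]. intros _. now apply Hlt.
      - rewrite L. split; [lia|]. intros _. apply F.
      - split; [|lia]. intros H. now apply Hgt in H. }
    destruct (proj1 (Ht x) (F x)) as (y & s & L & E). exact (Hx y s L E).
  (* With a gap in column [t], [e] is in the class of [i0], so [q] fires at arbitrarily large [y]
     and fills the column after all. *)
  - apply N. intros x. apply Ht, Q0, Hred. clear x. intros c x.
    destruct (Nat.lt_trichotomy c t) as [L|[->|L]].
    + apply tail_ext. intros y. rewrite H0, cfst_cpair.
      split; [now intros|]. intros _. now apply Hlt.
    + destruct (first_gap_exists (S n) (W e) t) as [k Hk].
      { intros [_ F]. now apply N. }
      rewrite (tail_gap _ _ _ _ _ Hk), (tail_gap (S n) (W i0) t 0).
      2:{ split; [lia|]. split; [|lia]. intros _. rewrite H0, cfst_cpair. lia. }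
      (* Column [t] is closed downward, hence empty beyond its first gap. *)
      rewrite H0, cfst_cpair. split; [|lia]. intros H.
      destruct (proj1 (proj2 Hk)); [lia|]. apply Ht in H as (y & s & L & E).
      apply Ht. exists y, s. split; [lia|exact E].
    + apply tail_ext. intros y. rewrite H0, cfst_cpair. split; [|lia].
      intros H. now apply Hgt in H.
Qed.

(** Let [q] fire when the element at the shift of stage [y] is enumerated: by [tail_limit] this
    occurs at all late [y] if [x] is in the tail, and at none otherwise. *)
Lemma tail_increases n t f i0 i1 c x :
  computable f -> t <= n ->
  (forall x y, tail_eq (S n) x y -> tail_eq n (f x) (f y)) ->
  (forall z, W i0 z <-> cfst z < t) ->
  (forall z, W i1 z <-> cfst z < S t) ->
  tail n (W (f i0)) c x -> tail n (W (f i1)) c x.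
Proof.
  intros Hf Htn Hred H0 H1 T0. apply NNPP. intros T1.
  apply (limit_obstruction n t f
    (fun u y s => pending u (cpair c (x + gap_at n c u y)) s) i0 i1); auto.
  - computability.
  - intros u Hu a. apply Hu in T0. destruct (tail_limit n u c) as [s0 Hs0].
    rewrite <- (Hs0 (a + s0)) in T0 by lia. apply W_pending in T0 as [s Hs].
    exists (a + s0), s. split; [lia|exact Hs].
  - intros u Hu. rewrite <- (Hu c x) in T1.
    destruct (tail_limit n u c) as [s0 Hs0]. exists s0. intros y s L E.
    apply T1. rewrite <- (Hs0 y L). apply W_pending. eauto.
Qed.

(** Now [q] fires when the shifted element is still missing at stage [y]. This limit is correct on
    columns that are not full: for [f i1] by hypothesis, for [f i0] because its tail misses [x]. *)
Lemma tail_constant n t f i0 i1 c x :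
  computable f -> t <= n ->
  (forall x y, tail_eq (S n) x y -> tail_eq n (f x) (f y)) ->
  (forall z, W i0 z <-> cfst z < t) ->
  (forall z, W i1 z <-> cfst z < S t) ->
  ~ full n (W (f i1)) c ->
  tail n (W (f i1)) c x -> tail n (W (f i0)) c x.
Proof.
  intros Hf Htn Hred H0 H1 N T1. apply NNPP. intros T0.
  assert (Hfull : forall u v, tail_eq n u v ->
            full n (W u) c -> full n (W v) c).
  { intros u v Huv F. apply full_of_tail; [apply F|].
    now apply Huv, tail_of_full. }
  apply (limit_obstruction n t f
    (fun u y _ => match pending u (cpair c (x + gap_at n c u y)) y with
                  | 0 => 1 | S _ => 0 end) i0 i1); auto.
  - computability.
  - intros u Hu a. rewrite <- (Hu c x) in T0.
    destruct (tail_limit_pending n u c x) as [s0 Hs0].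
    { intros F. now apply T0, tail_of_full. }
    exists (a + s0), 0. split; [lia|]. specialize (Hs0 (a + s0)).
    destruct (pending u _ _); [|reflexivity]. destruct T0. now apply Hs0; [lia|].
  - intros u Hu. apply Hu in T1.
    destruct (tail_limit_pending n u c x) as [s0 Hs0].
    { intros F. exact (N (Hfull _ _ Hu F)). }
    exists s0. intros y _ L. now rewrite (proj2 (Hs0 y L) T1).
Qed.

(* The sets formed by the first [t] columns, for [t <= n + 1], are pairwise
   inequivalent; along this chain [f] has to make a new column below [n] full
   at each step. *)
Lemma tail_eq_not_reducible n : ~ reducible (tail_eq (S n)) (tail_eq n).
Proof.
  intros (f & Hf & Hred).
  (* The difference is 0 exactly on the first [t] columns. *)
  destruct (uniform_index (fun t z _ => S (cfst z) - t)) as (h & _ & HW);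
    [computability|].
  assert (Hh : forall t z, W (h t) z <-> cfst z < t).
  { intros t z. rewrite HW. split; [intros [_ H]; lia|]. exists 0. lia. }
  assert (Hred' : forall x y, tail_eq (S n) x y -> tail_eq n (f x) (f y)).
  { intros x y. apply Hred. }
  assert (chain : forall t, t <= S n -> exists l, NoDup l /\ length l = t /\
            forall c, In c l -> full n (W (f (h t))) c).
  { induction t as [|t IH]; intros Hle.
    { exists nil. split; [constructor|]. split; [reflexivity|]. now intros. }
    destruct IH as (l & Hl & Hlen & Hfull); [lia|].
    assert (Hmono : forall c, full n (W (f (h t))) c -> full n (W (f (h (S t)))) c).
    { intros c F. apply full_of_tail; [apply F|].
      apply (tail_increases n t f (h t)); auto; [lia|]. now apply tail_of_full. }
    assert (Hnew : exists c,
      full n (W (f (h (S t)))) c /\ ~ full n (W (f (h t))) c).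
    { apply NNPP. intros N.
      (* This is absurd, as column [t] is full on the right and empty on the left. Without a newly
         full column the images would have equal tails, and the reduction would yield it. *)
      enough (E : tail_eq (S n) (h t) (h (S t))).
      { assert (F : full (S n) (W (h t)) t).
        { apply full_of_tail; [lia|]. apply E. intros k _.
          apply Hh. rewrite cfst_cpair. lia. }
        destruct F as [_ F]. specialize (F 0). apply Hh in F.
        rewrite cfst_cpair in F. lia. }
      apply Hred. intros c x. split.
      - apply (tail_increases n t); auto. lia.
      - intros T. destruct (classic (full n (W (f (h (S t)))) c)) as [F|F].
        + apply tail_of_full. apply NNPP. intros F'. apply N. eauto.
        + apply (tail_constant n t f (h t) (h (S t))); auto. lia. }
    destruct Hnew as (c & F & F'). exists (c :: l). repeat split.
    - constructor; auto.
    - cbn. now rewrite Hlen.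
    - destruct H as [<-|H]; [apply F|]. now apply Hmono, Hfull.
    - destruct H as [<-|H]; [apply F|]. now apply Hmono, Hfull. }
  destruct (chain (S n) (le_n _)) as (l & Hl & Hlen & Hfull).
  (* Pigeonhole: [n + 1] distinct full columns would all lie below [n]. *)
  assert (L : length l <= length (seq 0 n)).
  { apply NoDup_incl_length; [exact Hl|]. intros c Hc. apply in_seq.
    destruct (Hfull c Hc). lia. }
  rewrite length_seq in L. lia.
Qed.

Theorem theorem4p1 :
  exists R : nat -> nat -> nat -> Prop,
    forall n : nat, 1 <= n ->
      Equivalence (R n) /\
      enumerable_in_indices (R n) /\
      reducible eq_ce (R n) /\
      reducible (R n) E0_ce /\
      strictly_reducible (R n) (R (S n)).
Proof.
  exists tail_eq. intros n _.
  split; [apply tail_eq_equivalence|].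
  split; [apply tail_eq_enumerable|].
  split; [apply eq_ce_reducible_tail_eq|].
  split; [apply tail_eq_reducible_E0|].
  split; [apply tail_eq_reducible_succ | apply tail_eq_not_reducible].
Qed.
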